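(* Let $X,Y$ be compact convex sets, $d_g$ and $d_h$ Bregman divergences on $X$ and $Y$ respectively, and let $f:X\times Y\to\mathbb{R}$ be $(\sigma_X,\sigma_Y,L_X,L_Y)$-strongly Bregman convex-concave with respect to $d_g,d_h$. Suppose $f$ has a saddle point $(\mathbf{x}^*,\mathbf{y}^* )$. Let $(\mathbf{x}^0,\mathbf{y}^0)\in\mathrm{rint}(X)\times\mathrm{rint}(Y)$ and for $t\ge0$ $$\mathbf{x}^{t+1}=\arg\min_{\mathbf{x}\in X}\{\langle\nabla_{\mathbf{x}}f(\mathbf{x}^t,\mathbf{y}^t),\mathbf{x}-\mathbf{x}^t\rangle+2L_X\,d_g(\mathbf{x},\mathbf{x}^t)\},$$ $$\mathbf{y}^{t+1}=\arg\min_{\mathbf{y}\in Y}\{\langle-\nabla_{\mathbf{y}}f(\mathbf{x}^t,\mathbf{y}^t),\mathbf{y}-\mathbf{y}^t\rangle+2L_Y\,d_h(\mathbf{y},\mathbf{y}^t)\}.$$ Then for every $T\ge1$, $$f(\mathbf{x}^T,\mathbf{y}^* )-f(\mathbf{x}^*,\mathbf{y}^T)\le\left(1-\frac{\min\left\{\frac{\sigma_X}{L_X},\frac{\sigma_Y}{L_Y}\right\}}{2}\right)^{T-1}\Big((2L_X-\sigma_X)\,d_g(\mathbf{x}^*,\mathbf{x}^0)+(2L_Y-\sigma_Y)\,d_h(\mathbf{y}^*,\mathbf{y}^0)\Big).$$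
   Context: For a differentiable convex function $h$ on a compact convex set $C$, the Bregman divergence is $d_h(\mathbf{x},\mathbf{y})=h(\mathbf{x})-h(\mathbf{y})-\langle\nabla h(\mathbf{y}),\mathbf{x}-\mathbf{y}\rangle$ for $\mathbf{x}\in C$, $\mathbf{y}\in\mathrm{rint}(C)$ (relative interior). $f$ is differentiable on $\mathrm{rint}(X)\times\mathrm{rint}(Y)$. It is understood that the iterates exist and lie in the relative interiors, so the updates are well defined. Definition: for $0<\sigma_X\le L_X$ and $0<\sigma_Y\le L_Y$, $f$ is $(\sigma_X,\sigma_Y,L_X,L_Y)$-strongly Bregman convex-concave w.r.t. $d_g,d_h$ if for all $\mathbf{x}\in X$, $\mathbf{y}\in Y$, $\mathbf{x}'\in\mathrm{rint}(X)$, $\mathbf{y}'\in\mathrm{rint}(Y)$, $$-L_Y\,d_h(\mathbf{y},\mathbf{y}')+\sigma_X\,d_g(\mathbf{x},\mathbf{x}')\le f(\mathbf{x},\mathbf{y})-f(\mathbf{x}',\mathbf{y}')-\langle\nabla f(\mathbf{x}',\mathbf{y}'),(\mathbf{x},\mathbf{y})-(\mathbf{x}',\mathbf{y}')\rangle\le L_X\,d_g(\mathbf{x},\mathbf{x}')-\sigma_Y\,d_h(\mathbf{y},\mathbf{y}').$$ $(\mathbf{x}^*,\mathbf{y}^* )$ is a saddle point of $f$ if $f(\mathbf{x},\mathbf{y}^* )\ge f(\mathbf{x}^*,\mathbf{y}^* )\ge f(\mathbf{x}^*,\mathbf{y})$ for all $\mathbf{x}\in X$, $\mathbf{y}\in Y$.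 *)

(* Defs.v *)
From HB Require Import structures.
From mathcomp Require Import all_boot all_order all_algebra.
From mathcomp Require Import all_classical all_reals all_analysis.

Set Implicit Arguments.
Unset Strict Implicit.
Unset Printing Implicit Defensive.

Import Order.TTheory GRing.Theory Num.Theory.
Import numFieldNormedType.Exports.

Local Open Scope classical_set_scope.
Local Open Scope ring_scope.

Definition dotr (R : realType) (n : nat) (u v : 'rV[R]_n) : R :=
  \sum_(i < n) u 0 i * v 0 i.

Definition affine_hull (R : realType) (n : nat) (C : set 'rV[R]_n) :
    set 'rV[R]_n :=
  [set x | exists (k : nat) (c : 'I_k -> R) (p : 'I_k -> 'rV[R]_n),
     [/\ forall i, C (p i), \sum_(i < k) c i = 1 &
         x = \sum_(i < k) c i *: p i]].

Definition rint (R : realType) (n : nat) (C : set 'rV[R]_n) : set 'rV[R]_n :=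
  [set x | C x /\ within (affine_hull C) (nbhs x) C].

(* The increments are restricted to [C]: the function is only given on [C],
   which may have empty interior.  When the affine hull of [C] is proper, [p]
   is determined only up to a vector orthogonal to all differences of points
   of [C]; gradients are only ever paired with such differences. *)
Definition is_gradient (R : realType) (n : nat) (C : set 'rV[R]_n)
    (h : 'rV[R]_n -> R) (y p : 'rV[R]_n) : Prop :=
  forall eps : R, 0 < eps -> \forall x \near within C (nbhs y),
    `|h x - h y - dotr p (x - y)| <= eps * `|x - y|.

Definition differentiable_on_rint (R : realType) (n : nat) (C : set 'rV[R]_n)
    (h : 'rV[R]_n -> R) : Prop :=
  forall y, rint C y -> exists p, is_gradient C h y p.

Definition grad (R : realType) (n : nat) (C : set 'rV[R]_n)
    (h : 'rV[R]_n -> R) (y : 'rV[R]_n) : 'rV[R]_n :=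
  xget 0 [set p | is_gradient C h y p].

Definition bregman_potential (R : realType) (n : nat) (C : set 'rV[R]_n)
    (h : 'rV[R]_n -> R) : Prop :=
  convex_function (E := 'rV[R]_n) C h /\ differentiable_on_rint C h.

Definition bregman (R : realType) (n : nat) (C : set 'rV[R]_n)
    (h : 'rV[R]_n -> R) (x y : 'rV[R]_n) : R :=
  h x - h y - dotr (grad C h y) (x - y).

(* R^n x R^m is identified with R^(n + m) through [row_mx]. *)
Definition prod_set (R : realType) (n m : nat)
    (X : set 'rV[R]_n) (Y : set 'rV[R]_m) : set 'rV[R]_(n + m) :=
  [set z | X (lsubmx z) /\ Y (rsubmx z)].

Definition joint (R : realType) (n m : nat) (f : 'rV[R]_n -> 'rV[R]_m -> R)
    (z : 'rV[R]_(n + m)) : R :=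
  f (lsubmx z) (rsubmx z).

Definition differentiable_on_rints (R : realType) (n m : nat)
    (X : set 'rV[R]_n) (Y : set 'rV[R]_m)
    (f : 'rV[R]_n -> 'rV[R]_m -> R) : Prop :=
  forall x y, rint X x -> rint Y y ->
    exists p, is_gradient (prod_set X Y) (joint f) (row_mx x y) p.

Definition grad_joint (R : realType) (n m : nat)
    (X : set 'rV[R]_n) (Y : set 'rV[R]_m) (f : 'rV[R]_n -> 'rV[R]_m -> R)
    (x : 'rV[R]_n) (y : 'rV[R]_m) : 'rV[R]_(n + m) :=
  grad (prod_set X Y) (joint f) (row_mx x y).

Definition grad_x (R : realType) (n m : nat)
    (X : set 'rV[R]_n) (Y : set 'rV[R]_m) (f : 'rV[R]_n -> 'rV[R]_m -> R)
    (x : 'rV[R]_n) (y : 'rV[R]_m) : 'rV[R]_n :=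
  lsubmx (grad_joint X Y f x y).

Definition grad_y (R : realType) (n m : nat)
    (X : set 'rV[R]_n) (Y : set 'rV[R]_m) (f : 'rV[R]_n -> 'rV[R]_m -> R)
    (x : 'rV[R]_n) (y : 'rV[R]_m) : 'rV[R]_m :=
  rsubmx (grad_joint X Y f x y).

Definition strongly_bregman_convex_concave (R : realType) (n m : nat)
    (X : set 'rV[R]_n) (Y : set 'rV[R]_m)
    (g : 'rV[R]_n -> R) (h : 'rV[R]_m -> R) (sX sY LX LY : R)
    (f : 'rV[R]_n -> 'rV[R]_m -> R) : Prop :=
  [/\ 0 < sX <= LX, 0 < sY <= LY &
      forall x y x' y', X x -> Y y -> rint X x' -> rint Y y' ->
        - LY * bregman Y h y y' + sX * bregman X g x x'
          <= f x y - f x' y'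
             - dotr (grad_joint X Y f x' y') (row_mx x y - row_mx x' y')
          <= LX * bregman X g x x' - sY * bregman Y h y y'].

Definition saddle_point (R : realType) (n m : nat)
    (X : set 'rV[R]_n) (Y : set 'rV[R]_m)
    (f : 'rV[R]_n -> 'rV[R]_m -> R) (xs : 'rV[R]_n) (ys : 'rV[R]_m) : Prop :=
  [/\ X xs, Y ys &
      forall x y, X x -> Y y -> f xs y <= f xs ys <= f x ys].

Definition argmin_set (R : realType) (n : nat) (C : set 'rV[R]_n)
    (F : 'rV[R]_n -> R) : set 'rV[R]_n :=
  [set x | C x /\ forall z, C z -> F x <= F z].

(* Main.v *)
Require Import Defs.
From HB Require Import structures.
From mathcomp Require Import all_boot all_order all_algebra.
From mathcomp Require Import all_classical all_reals all_analysis.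
Import Order.TTheory GRing.Theory Num.Theory.
Import numFieldNormedType.Exports.
Local Open Scope classical_set_scope.
Local Open Scope ring_scope.
From mathcomp Require Import lra.

Set Implicit Arguments.
Unset Strict Implicit.
Unset Printing Implicit Defensive.

(* With [D t := d_g(xs, x t)] and [E t := d_h(ys, y t)], apply the upper bound
   on [f] at [(x t.+1, ys)] and the lower bound at [(xs, y t.+1)], both expanded
   at the current iterate, and eliminate the gradients with the three-point
   inequality of each proximal step:
     gap t.+1 <= (2 LX - sX) D t + (2 LY - sY) E t - 2 LX D t.+1 - 2 LY E t.+1.
   As the gap is nonnegative at a saddle point, the potential
   [2 LX D t + 2 LY E t] contracts by the factor [1 - min(sX/LX, sY/LY) / 2]. *)

Section inner_product.
Context {R : realType} {n : nat}.
Implicit Types p q u v : 'rV[R]_n.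

Lemma dotrDr p u v : dotr p (u + v) = dotr p u + dotr p v.
Proof. by rewrite /dotr -big_split; apply: eq_bigr => i _; rewrite mxE mulrDr. Qed.

Lemma dotrZr p (s : R) u : dotr p (s *: u) = s * dotr p u.
Proof. by rewrite /dotr mulr_sumr; apply: eq_bigr => i _; rewrite mxE mulrCA. Qed.

Lemma dotrBr p u v : dotr p (u - v) = dotr p u - dotr p v.
Proof. by rewrite -scaleN1r dotrDr dotrZr mulN1r. Qed.

Lemma dotrNl p u : dotr (- p) u = - dotr p u.
Proof. by rewrite /dotr -sumrN; apply: eq_bigr => i _; rewrite mxE mulNr. Qed.

End inner_product.

Lemma dotr_row_mx (R : realType) (n m : nat) (p : 'rV[R]_(n + m))
    (u : 'rV[R]_n) (v : 'rV[R]_m) :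
  dotr p (row_mx u v) = dotr (lsubmx p) u + dotr (rsubmx p) v.
Proof.
rewrite /dotr big_split_ord /=; congr (_ + _); apply: eq_bigr => i _.
  by rewrite row_mxEl mxE.
by rewrite row_mxEr mxE.
Qed.

Section one_variable.
Context {R : realType} {n : nat} {C : set 'rV[R]_n} {h : 'rV[R]_n -> R}.
Implicit Types (u w z p : 'rV[R]_n) (s : R).
Hypothesis C_convex : convex_set (M := 'rV[R]_n) C.

Lemma segmentE u z s : u + s *: (z - u) = s *: z + (1 - s) *: u.
Proof. by rewrite scalerBr scalerBl scale1r addrCA. Qed.

Lemma convex_set_segment u z s : C u -> C z -> 0 <= s -> s <= 1 ->
  C (u + s *: (z - u)).
Proof.
move=> Cu Cz s0 s1; rewrite segmentE.
by have := @C_convex z u (Itv01 s0 s1) (mem_set Cz) (mem_set Cu); rewrite inE.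
Qed.

Lemma convex_function_segment u z s :
  convex_function (E := 'rV[R]_n) C h -> C u -> C z -> 0 <= s -> s <= 1 ->
  h (u + s *: (z - u)) <= h u + s * (h z - h u).
Proof.
move=> cvxh Cu Cz s0 s1; rewrite segmentE.
have cvx_zu : h (s *: z + (1 - s) *: u) <= s * h z + (1 - s) * h u :=
  cvxh (Itv01 s0 s1) z u (mem_set Cz) (mem_set Cu).
lra.
Qed.

Lemma is_gradient_grad u :
  differentiable_on_rint C h -> rint C u -> is_gradient C h u (grad C h u).
Proof. by move=> diffh /diffh; exact: xgetPex. Qed.

(** Stands in for the directional derivative at [u] towards [z]: one step [s] with error [s * e]
    suffices, since the users divide by [s] and then let [e] tend to 0. *)
Lemma is_gradient_segment u z p e : is_gradient C h u p -> C u -> C z -> 0 < e ->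
  exists s : R, [/\ 0 < s, s <= 1 &
    `|h (u + s *: (z - u)) - h u - s * dotr p (z - u)| <= s * e].
Proof.
move=> gradp Cu Cz e0.
(* The [+ 1] keeps [k] positive when [z = u]. *)
set k := `|z - u| + 1; have k0 : 0 < k by rewrite ltr_wpDl.
have /gradp : 0 < e / k by rewrite divr_gt0.
rewrite near_withinE => /nbhs_normP[r /= r0 near_u].
(* The bound 1 keeps the point on the segment, hence in [C]; the factor 2 puts it strictly inside
   the ball of radius [r]. *)
exists (Num.min 1 (r / (2 * k))); set s := Num.min _ _.
have s0 : 0 < s by rewrite lt_min ltr01 divr_gt0// mulr_gt0.
have s1 : s <= 1 by rewrite ge_min lexx.
split => //.
have szu : `|s *: (z - u)| = s * `|z - u| by rewrite normrZ gtr0_norm.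
have Csz : C (u + s *: (z - u)) by exact: convex_set_segment Cu Cz (ltW s0) s1.
have szE : u + s *: (z - u) - u = s *: (z - u) by rewrite addrAC subrr add0r.
have sk : s * `|z - u| <= s * k by rewrite ler_pM2l// lerDl.
have sr : s * k < r.
  have : s * (2 * k) <= r by rewrite -ler_pdivlMr ?mulr_gt0// ge_min lexx orbT.
  have : 0 < s * k by rewrite mulr_gt0.
  lra.
have ball_sz : `|u - (u + s *: (z - u))| < r.
  by rewrite distrC szE szu (le_lt_trans sk).
have := near_u _ ball_sz Csz; rewrite szE dotrZr szu => /le_trans; apply.
by rewrite mulrCA ler_pM2l// mulrAC ler_pdivrMr// ler_pM2l// lerDl.
Qed.

(** Along the segment, convexity bounds the increment of [h] above by [s * (h z - h u)], and the
    gradient bounds it below by [s * (dotr (grad C h u) (z - u) - e)]. *)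
Lemma bregman_ge0 u z : bregman_potential C h -> rint C u -> C z ->
  0 <= bregman C h z u.
Proof.
move=> [cvxh diffh] ru Cz; have Cu := ru.1.
apply/ler_addgt0Pr => e e0.
have [s [s0 s1]] := is_gradient_segment (is_gradient_grad diffh ru) Cu Cz e0.
have := convex_function_segment cvxh Cu Cz (ltW s0) s1.
rewrite ler_norml => le_h /andP[ge_h _].
rewrite /bregman -(ler_pM2l s0) mulr0.
lra.
Qed.

(* The objective [z |-> <G, z - w> + c d_h(z, w)] has gradient
   [G + c (grad h u - grad h w)] at its minimizer [u], so this vector pairs
   nonnegatively with [z - u]; the identity
   [d(z, w) - d(z, u) - d(u, w) = <grad h u - grad h w, z - u>] concludes. *)
Lemma bregman_prox (G w u z : 'rV[R]_n) (c : R) :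
  differentiable_on_rint C h -> 0 <= c -> rint C u -> C z ->
  argmin_set C (fun v => dotr G (v - w) + c * bregman C h v w) u ->
  dotr G (u - z) <= c * (bregman C h z w - bregman C h z u - bregman C h u w).
Proof.
move=> diffh c0 ru Cz [Cu min_u].
apply/ler_addgt0Pr => e e0.
(* Dividing by [c + 1] allows [c = 0] and still gives [c * (e / (c + 1)) <= e]. *)
have e'0 : 0 < e / (c + 1) by rewrite divr_gt0// ltr_wpDl.
have [s [s0 s1]] := is_gradient_segment (is_gradient_grad diffh ru) Cu Cz e'0.
rewrite ler_norml => /andP[_ le_h].
have := min_u _ (convex_set_segment Cu Cz (ltW s0) s1).
have {le_h} : c * (h (u + s *: (z - u)) - h u - s * dotr (grad C h u) (z - u))
    <= s * e.
  apply: (le_trans (ler_wpM2l c0 le_h)); rewrite mulrCA ler_pM2l//.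
  by rewrite mulrA ler_pdivrMr ?ltr_wpDl//; rewrite mulrC ler_pM2l// lerDl.
rewrite /bregman !(dotrBr, dotrDr, dotrZr) => le_h le_F.
rewrite -(ler_pM2l s0); lra.
Qed.

End one_variable.

Theorem theorem3p5 (R : realType) (n m : nat)
    (X : set 'rV[R]_n) (Y : set 'rV[R]_m)
    (g : 'rV[R]_n -> R) (h : 'rV[R]_m -> R)
    (f : 'rV[R]_n -> 'rV[R]_m -> R) (sX sY LX LY : R)
    (xs : 'rV[R]_n) (ys : 'rV[R]_m)
    (x : nat -> 'rV[R]_n) (y : nat -> 'rV[R]_m)
    (X_compact : compact X) (X_convex : convex_set (M := 'rV[R]_n) X)
    (Y_compact : compact Y) (Y_convex : convex_set (M := 'rV[R]_m) Y)
    (g_potential : bregman_potential X g)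
    (h_potential : bregman_potential Y h)
    (f_diff : differentiable_on_rints X Y f)
    (f_sbcc : strongly_bregman_convex_concave X Y g h sX sY LX LY f)
    (f_saddle : saddle_point X Y f xs ys)
    (x_rint : forall t, rint X (x t)) (y_rint : forall t, rint Y (y t))
    (x_step : forall t, argmin_set X
       (fun u => dotr (grad_x X Y f (x t) (y t)) (u - x t)
                 + 2 * LX * bregman X g u (x t)) (x t.+1))
    (y_step : forall t, argmin_set Y
       (fun v => dotr (- grad_y X Y f (x t) (y t)) (v - y t)
                 + 2 * LY * bregman Y h v (y t)) (y t.+1)) :
  forall T : nat, (1 <= T)%N ->
    f (x T) ys - f xs (y T)
      <= (1 - Num.min (sX / LX) (sY / LY) / 2) ^+ (T - 1)
         * ((2 * LX - sX) * bregman X g xs (x 0%N)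
            + (2 * LY - sY) * bregman Y h ys (y 0%N)).
Proof.
have [/andP[sX0 sXL] /andP[sY0 sYL] f_bounds] := f_sbcc.
have [Xxs Yys saddle] := f_saddle.
have LX0 : 0 < LX by exact: lt_le_trans sXL.
have LY0 : 0 < LY by exact: lt_le_trans sYL.
pose D t := bregman X g xs (x t); pose E t := bregman Y h ys (y t).
have D0 t : 0 <= D t
  by exact (bregman_ge0 X_convex g_potential (x_rint t) Xxs).
have E0 t : 0 <= E t
  by exact (bregman_ge0 Y_convex h_potential (y_rint t) Yys).
(* The induction runs on [A] rather than on the potential, so that [A 0] carries the constants of
   the conclusion. *)
pose A t := (2 * LX - sX) * D t + (2 * LY - sY) * E t.
have gap_step t : f (x t.+1) ys - f xs (y t.+1)
    <= A t - (2 * LX * D t.+1 + 2 * LY * E t.+1).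
  have [Xx Yy] := ((x_rint t.+1).1, (y_rint t.+1).1).
  have dx0 := bregman_ge0 X_convex g_potential (x_rint t) Xx.
  have dy0 := bregman_ge0 Y_convex h_potential (y_rint t) Yy.
  have LX20 : 0 <= 2 * LX by rewrite mulr_ge0// ltW.
  have LY20 : 0 <= 2 * LY by rewrite mulr_ge0// ltW.
  have prox_x :=
    bregman_prox X_convex g_potential.2 LX20 (x_rint t.+1) Xxs (x_step t).
  have prox_y :=
    bregman_prox Y_convex h_potential.2 LY20 (y_rint t.+1) Yys (y_step t).
  have /andP[_ ub] := f_bounds _ _ _ _ Xx Yys (x_rint t) (y_rint t).
  have /andP[lb _] := f_bounds _ _ _ _ Xxs Yy (x_rint t) (y_rint t).
  move: ub lb prox_x prox_y.
  rewrite !opp_row_mx !add_row_mx !dotr_row_mx -/(grad_x X Y f (x t) (y t)).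
  rewrite -/(grad_y X Y f (x t) (y t)) dotrNl !dotrBr -/(D t) -/(E t).
  rewrite -/(D t.+1) -/(E t.+1) /A.
  (* The proximal steps contribute [- 2 * LX] times the divergence from [x t] to [x t.+1], the
     smoothness bound only [+ LX]; the surplus is dropped by nonnegativity, and likewise in [y]. *)
  have := mulr_ge0 (ltW LX0) dx0; have := mulr_ge0 (ltW LY0) dy0.
  lra.
have gap_ge0 t : 0 <= f (x t) ys - f xs (y t).
  rewrite subr_ge0.
  by have /andP[/le_trans] := saddle _ _ (x_rint t).1 (y_rint t).1; apply.
set mu := Num.min _ _; set rho := 1 - mu / 2.
have muX : mu * LX <= sX by rewrite -ler_pdivlMr// ge_min lexx.
have muY : mu * LY <= sY by rewrite -ler_pdivlMr// ge_min lexx orbT.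
have rho0 : 0 <= rho.
  have : mu <= 1 by rewrite ge_min ler_pdivrMr// mul1r sXL.
  rewrite /rho; lra.
(* Indeed [2 * LX - sX <= (2 - mu) * LX = rho * (2 * LX)], and likewise for [Y]. *)
have A_le t : A t <= rho * (2 * LX * D t + 2 * LY * E t).
  have := ler_wpM2r (D0 t) muX; have := ler_wpM2r (E0 t) muY.
  rewrite /A /rho; lra.
have A_rec t : A t.+1 <= rho * A t.
  apply: (le_trans (A_le _)); apply: ler_wpM2l => //.
  by have := le_trans (gap_ge0 t.+1) (gap_step t); rewrite subr_ge0.
have A_geo t : A t <= rho ^+ t * A 0%N.
  elim: t => [|t IHt]; first by rewrite expr0 mul1r.
  by rewrite exprS -mulrA (le_trans (A_rec t))// ler_wpM2l.
(* The last step uses [gap_step] alone, without a contraction, hence the exponent [T - 1]. *)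
case=> // t _; rewrite subn1 /=.
apply: le_trans (A_geo t); apply: (le_trans (gap_step t)).
have := mulr_ge0 (ltW LX0) (D0 t.+1); have := mulr_ge0 (ltW LY0) (E0 t.+1).
lra.
Qed.
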